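(* With $C_1,\ldots,C_4$, ${\cal V}$, ${\cal U}$ and ${\cal W}$ as defined in the context, one has ${\cal V}={\cal U}\cup{\cal W}$.
   Context: Let $\alpha_j,\beta_j\in{\bf C}^*$, $\alpha_j\ne\beta_j$, $j=1,2,3$, satisfy $\alpha_1\beta_1\alpha_2\beta_2\alpha_3\beta_3=1$ and be relatively generic: for integers $m\in\{1,2,3\}$ and $k_1,k_2,k_3$ with $0\le k_j\le2$, $0\le m-k_j\le2$, the equality $(-1)^m\prod_{j=1}^3\alpha_j^{k_j}\beta_j^{m-k_j}=1$ holds only for $m=2$, $k_1=k_2=k_3=1$. For $j=1,2,3$ let $C_j\subset GL(4,{\bf C})$ be the conjugacy class of diagonalizable matrices with eigenvalues $\alpha_j,\beta_j$, each of multiplicity $2$; let $C_4$ be the conjugacy class of matrices with the single eigenvalue $-1$ and with three Jordan blocks, of sizes $2,1,1$. Set ${\cal V}=\{(M_1,\ldots,M_4)~|~M_j\in C_j,~M_1M_2M_3M_4=I\}$. Quadruples of matrices $N_j\in GL(2,{\bf C})$: $N_j$ is diagonalizable with eigenvalues $\alpha_j,\beta_j$ for $j=1,2,3$, $N_4=-I$, $N_1N_2N_3N_4=I$. Quadruples of matrices $P_j\in GL(2,{\bf C})$: $P_j$ is diagonalizable with eigenvalues $\alpha_j,\beta_j$ for $j=1,2,3$, $P_4$ is conjugate to a Jordan block of size $2$ with eigenvalue $-1$, $P_1P_2P_3P_4=I$. (By the genericity of their eigenvalues all such quadruples are irreducible.) ${\cal U}$ is the set of quadruples in ${\cal V}$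 which are simultaneously conjugate to a quadruple $M_j=\left(\begin{array}{cc}N_j&0\\0&P_j\end{array}\right)$ with $(N_j)$, $(P_j)$ as described. ${\cal W}$ is the set of quadruples in ${\cal V}$ which are simultaneously conjugate to a quadruple $M_j=\left(\begin{array}{cc}N_j&R_j\\0&N_j\end{array}\right)$ with $(N_j)$ as described, $R_j\in gl(2,{\bf C})$ (so $M_1,M_2,M_3$ are diagonalizable and ${\rm rk}\,R_4=1$). *)

(* Defs.v *)
From mathcomp Require Import all_boot all_order all_algebra.
From mathcomp Require Import classical_sets reals complex.

Set Implicit Arguments.
Unset Strict Implicit.
Unset Printing Implicit Defensive.

Import GRing.Theory.
Local Open Scope ring_scope.
Local Open Scope classical_set_scope.

(* The indices 1, 2, 3 and 1, 2, 3, 4 are rendered by 'I_3 and 'I_4: [emb3]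
   sends 1, 2, 3 to the first three indices, and [ord_max : 'I_4] is 4. *)
Definition emb3 (j : 'I_3) : 'I_4 := widen_ord (leqnSn 3) j.

Section Quadruples.
Variable F : fieldType.

Definition quad (n : nat) : Type := 'I_4 -> 'M[F]_n.

(* For a <> b: diagonalizable with eigenvalues a and b, each of multiplicity
   m.  (In size n = 2 * m this is a single conjugacy class.) *)
Definition diag_class (n m : nat) (a b : F) : set 'M[F]_n :=
  [set A | diagonalizable A /\
           char_poly A = ('X - a%:P) ^+ m * ('X - b%:P) ^+ m].

Definition jordan_block (n : nat) (c : F) : 'M[F]_n :=
  \matrix_(i, j) (if i == j then c else if i.+1 == j :> nat then 1 else 0).

Definition conj_class (n : nat) (J : 'M[F]_n) : set 'M[F]_n :=
  [set A | A ~_{in unitmx} J].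

Definition jordan_211 (c : F) : 'M[F]_4 :=
  block_mx (jordan_block 2 c) 0
           0 (block_mx (jordan_block 1 c) 0
                       0 (jordan_block 1 c)).

(* Since the matrices are square, this also forces each of them to be invertible,
   so membership in GL(n) is not required separately below. *)
Definition prod_is_id (n : nat) (M : quad n) : Prop :=
  M 0 *m M 1 *m M 2 *m M 3 = 1%:M.

Definition simultaneously_conj (n : nat) (M B : quad n) : Prop :=
  exists2 Q : 'M[F]_n, Q \in unitmx & forall j, M j ~_Q B j.

Definition relatively_generic (alpha beta : 'I_3 -> F) : Prop :=
  forall (m : nat) (k : 'I_3 -> nat),
    (1 <= m <= 3)%N ->
    (forall j, (k j <= 2)%N /\ (k j <= m)%N /\ (m - k j <= 2)%N) ->
    (-1) ^+ m * \prod_(j < 3) (alpha j ^+ k j * beta j ^+ (m - k j)) = 1 ->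
    m = 2%N /\ forall j, k j = 1%N.

Section Varieties.
Variables alpha beta : 'I_3 -> F.

Definition calV : set (quad 4) :=
  [set M | [/\ forall j : 'I_3, diag_class 2 (alpha j) (beta j) (M (emb3 j)),
               conj_class (jordan_211 (-1)) (M ord_max)
             & prod_is_id M]].

Definition Nquad : set (quad 2) :=
  [set N | [/\ forall j : 'I_3, diag_class 1 (alpha j) (beta j) (N (emb3 j)),
               N ord_max = - 1%:M
             & prod_is_id N]].

Definition Pquad : set (quad 2) :=
  [set P | [/\ forall j : 'I_3, diag_class 1 (alpha j) (beta j) (P (emb3 j)),
               conj_class (jordan_block 2 (-1)) (P ord_max)
             & prod_is_id P]].

Definition calU : set (quad 4) :=
  [set M | calV M /\
     exists N P : quad 2, [/\ Nquad N, Pquad P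
       & simultaneously_conj M
           (fun j => block_mx (N j) 0 0 (P j) : 'M[F]_(2 + 2))]].

Definition calW : set (quad 4) :=
  [set M | calV M /\
     exists N R : quad 2, Nquad N /\
       simultaneously_conj M
         (fun j => block_mx (N j) (R j) 0 (N j) : 'M[F]_(2 + 2))].

End Varieties.
End Quadruples.

(* Main.v *)
From HB Require Import structures.
Require Import Defs.
From mathcomp Require Import all_boot all_order all_algebra.
From mathcomp Require Import classical_sets reals complex.
From mathcomp Require Import mxtens ring zify.

(* Fix a quadruple N of 2 x 2 matrices as in the definition of calW (one is
   written down explicitly); by genericity its matrices have no common
   eigenvector.  For M in calV, Scott's inequality applied to the action of
   X |-> (N j)^-1 X (M j) on 2 x 4 matrices gives
   dim Hom(N, M) + dim Hom(M, N) >= 2 * 8 - (4 + 4 + 4 + 2) = 2.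
   Neither dimension exceeds 1: two independent maps N -> M would identify M
   with N + N, although M 3 (M_4 in the paper, indices starting here at 0) is
   not the scalar -1, and dually.  So there are nonzero X : N -> M and
   Y : M -> N, respectively injective and surjective.
   If the composite N -> M -> N is invertible, M is the direct sum of N and
   ker Y, and M is in calU; if it vanishes, the image of X is ker Y and M is an
   extension of N by itself, hence in calW. *)

Set Implicit Arguments.
Unset Strict Implicit.
Unset Printing Implicit Defensive.

Import GRing.Theory.
Local Open Scope ring_scope.

(** * Similarity, diagonalizable matrices and small Jordan forms *)

Section Matrices.
Variable F : fieldType.

Lemma char_poly_trmx n (A : 'M[F]_n) : char_poly A^T = char_poly A.
Proof.
rewrite /char_poly -[in RHS]det_tr; congr (\det _).
by apply/matrixP=> i j; rewrite !mxE eq_sym.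
Qed.

(** The relation lifts to the characteristic matrices over the polynomial ring, where the
    determinant of [q] is a nonzero constant and cancels. *)
Lemma char_poly_simmx n (Q A B : 'M[F]_n) : Q \in unitmx ->
  Q *m A = B *m Q -> char_poly A = char_poly B.
Proof.
move=> Qu QA; set q := map_mx (@polyC F) Q.
have: q *m char_poly_mx A = char_poly_mx B *m q.
  by rewrite mulmxBr mulmxBl scalar_mxC -!map_mxM QA.
move/(congr1 determinant); rewrite !det_mulmx mulrC => /mulIf; apply.
by rewrite det_map_mx polyC_eq0 -unitfE -unitmxE.
Qed.

Lemma char_poly_block_diag m n (A : 'M[F]_m) (B : 'M[F]_n) :
  char_poly (block_mx A 0 0 B) = char_poly A * char_poly B.
Proof. by rewrite /char_poly char_block_diag_mx det_ublock. Qed.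

Lemma eigen_row_root n (A : 'M[F]_n) (v : 'rV_n) g :
  v *m A = g *: v -> v != 0 -> root (char_poly A) g.
Proof.
by move=> vA v0; rewrite -eigenvalue_root_char; apply/eigenvalueP; exists v.
Qed.

Lemma eigen_col_root n (A : 'M[F]_n) (v : 'cV_n) g :
  A *m v = g *: v -> v != 0 -> root (char_poly A) g.
Proof.
move=> Av v0; rewrite -char_poly_trmx; apply: (@eigen_row_root _ _ v^T).
  by rewrite -trmx_mul Av linearZ.
by rewrite trmx_eq0.
Qed.

Lemma mxrank_sum_leq m n (I : Type) (r : seq I) (A : I -> 'M[F]_(m, n)) :
  (\rank (\sum_(i <- r) A i)%R <= \sum_(i <- r) \rank (A i))%N.
Proof.
elim/big_rec2: _ => [|i k B _ IH]; first by rewrite mxrank0.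
by apply: leq_trans (mxrank_add _ _) _; rewrite leq_add2l.
Qed.

Lemma mxrank_diag_leq n (d : 'rV[F]_n) :
  (\rank (diag_mx d) <= \sum_i (d ord0 i != 0%R))%N.
Proof.
rewrite diag_mx_sum_delta; apply: leq_trans (mxrank_sum_leq _ _) _.
apply: leq_sum => i _; case: eqP => [->|_]; first by rewrite scale0r mxrank0.
by apply: leq_trans (mxrank_scale _ _) _; rewrite mxrank_delta.
Qed.

(** The characteristic polynomial determines the diagonal form [d] up to order, and the rank of
    [A - c%:M] is at most the number of entries of [d] other than [c]. *)
Lemma diag_class_rank n m (a b : F) (A : 'M[F]_n) : a != b ->
    diag_class m a b A ->
  (\rank (A - a%:M)%R <= m)%N /\ (\rank (A - b%:M)%R <= m)%N.
Proof.
move=> ab [[Q Qu /diagonalizable_forPex[d /(simmxP Qu) QA]] chA].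
have chd : perm_eq [seq d 0 i | i <- enum 'I_n] (nseq m a ++ nseq m b).
  apply: prod_XsubC_eq; rewrite big_cat !big_nseq -!Monoid.iteropE big_image /=.
  rewrite -chA (char_poly_simmx Qu QA) char_poly_trig ?diag_mx_is_trig //.
  by apply: eq_bigr => i _; rewrite !mxE eqxx.
have rk c : (\rank (A - c%:M)%R <= count (predC1 c) (nseq m a ++ nseq m b))%N.
  rewrite -(permP chd) count_map -sum1_count big_mkcond big_enum /=.
  have: Q *m (A - c%:M) = (diag_mx d - c%:M) *m Q.
    by rewrite mulmxBr mulmxBl QA scalar_mxC.
  move/(canRL (mulKmx Qu)) ->.
  apply: leq_trans (mxrankM_maxr _ _) _; apply: leq_trans (mxrankM_maxl _ _) _.
  rewrite -diag_const_mx -raddfB /=; apply: leq_trans (mxrank_diag_leq _) _.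
  by apply: leq_sum => i _; rewrite !mxE subr_eq0; case: (_ == _).
split; apply: leq_trans (rk _) _; rewrite count_cat !count_nseq /= eqxx /=.
  by rewrite mul0n; case: (_ == _); rewrite ?mul0n ?mul1n.
by rewrite mul0n addn0; case: (_ == _); rewrite ?mul0n ?mul1n.
Qed.

(** The minimal polynomial divides a product of distinct linear factors. Size 0 is excluded by
    polynomial sizes, 1 against 3. *)
Lemma diag_class1 n (a b : F) (A : 'M[F]_n) : a != b ->
  char_poly A = ('X - a%:P) * ('X - b%:P) -> diag_class 1 a b A.
Proof.
case: n A => [|n] A ab chA.
  have := congr1 (size \o @polyseq F) chA.
  by rewrite /= size_char_poly size_mul ?polyXsubC_eq0 // !size_XsubC.
split; last by rewrite !expr1.
apply/diagonalizableP; exists [:: a; b]; first by rewrite /= inE ab.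
by rewrite !big_cons big_nil mulr1 -chA mxminpoly_dvd_char.
Qed.

Lemma char_poly2 (A : 'M[F]_2) (a b : F) : \tr A = a + b -> \det A = a * b ->
  char_poly A = ('X - a%:P) * ('X - b%:P).
Proof.
move=> trA detA; have sz : size (char_poly A) = 3 by rewrite size_char_poly.
have -> : ('X - a%:P) * ('X - b%:P) = 'X^2 - (a + b) *: 'X + (a * b)%:P.
  by rewrite -mul_polyC polyCD polyCM; ring.
apply/polyP=> -[|[|[|k]]];
  rewrite !(coefD, coefN, coefZ, coefXn, coefX, coefC) /=.
- by rewrite char_poly_det detA; ring.
- by have := char_poly_trace A isT; rewrite /= => ->; rewrite trA; ring.
- by have /monicP := char_poly_monic A; rewrite lead_coefE sz /= => ->; ring.
- by rewrite nth_default ?sz // mulr0 subr0 addr0.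
Qed.

(** With [E] the nilpotent part and [q] a unit row vector not killed by [E], the rows [q] and
    [q *m E] form a Jordan basis. *)
Lemma nilpotent2_jordan (c : F) (A : 'M[F]_2) :
  A - c%:M != 0 -> (A - c%:M) *m (A - c%:M) = 0 ->
  conj_class (jordan_block 2 c) A.
Proof.
set E := A - c%:M => E0 EE.
have [i Ei] : exists i, row i E != 0.
  apply/existsP; apply: contraNT E0 => /existsPn E0.
  apply/eqP/row_matrixP=> i; rewrite row0; apply/eqP.
  by have := E0 i; rewrite negbK.
pose q : 'rV[F]_2 := delta_mx 0 i.
have qE : q *m E != 0 by rewrite -rowE.
pose Q : 'M[F]_(1 + 1, 2) := col_mx q (q *m E).
have Qfree : row_free Q.
  apply: inj_row_free => v; rewrite -[v]hsubmxK mul_row_col => h.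
  have l0 : lsubmx v = 0.
    have : (lsubmx v *m q + rsubmx v *m (q *m E)) *m E = 0 by rewrite h mul0mx.
    rewrite mulmxDl -!mulmxA EE !mulmx0 addr0.
    rewrite [lsubmx v]mx11_scalar mul_scalar_mx.
    by move/eqP; rewrite scaler_eq0 (negPf qE) orbF => /eqP ->; rewrite raddf0.
  move: h; rewrite l0 mul0mx add0r [rsubmx v]mx11_scalar mul_scalar_mx.
  move/eqP; rewrite scaler_eq0 (negPf qE) orbF => /eqP ->.
  by rewrite raddf0 row_mx0.
have QA : Q *m A = (block_mx c%:M 1%:M 0 c%:M : 'M[F]_(1 + 1)) *m Q.
  rewrite mul_block_col mul_col_mx mul1mx !mul_scalar_mx mul0mx add0r.
  have EA p (w : 'M_(p, 2)) : w *m A = c *: w + w *m E.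
    by rewrite mulmxBr mul_mx_scalar addrC subrK.
  by rewrite !EA -(mulmxA q) EE mulmx0 addr0.
exists Q; first by rewrite -row_free_unit.
apply: simmxW => //; rewrite [LHS]QA; congr (_ *m _).
apply/matrixP=> k l; rewrite !mxE.
case: splitP => k' /= ek; rewrite !mxE; case: splitP => l' /= el;
  by rewrite -val_eqE /= ek el (ord1 k') (ord1 l') ?mxE.
Qed.

Lemma jordan_211E (c : F) : jordan_211 c = c%:M + delta_mx 0 1.
Proof.
apply/matrixP=> k l; rewrite /jordan_211 !mxE.
case: splitP => k' ek; rewrite !mxE; case: splitP => l' el; rewrite !mxE;
  rewrite -?[k == l]val_eqE -?[k == 0]val_eqE -?[l == 1]val_eqE /= ek el.
1-3: by case: k' l' {ek el} => [[|[|[]]] ?] // [[|[|[]]] ?];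
     rewrite //= ?addr0 ?add0r.
case: splitP => k'' ek'; rewrite !mxE; case: splitP => l'' el';
  by rewrite !mxE ek' el' (ord1 k'') (ord1 l'') addr0.
Qed.

End Matrices.

Lemma ord4P (P : 'I_4 -> Prop) : P 0 -> P 1 -> P 2 -> P 3 -> forall i, P i.
Proof.
move=> P0 P1 P2 P3 [[|[|[|[|//]]]] lti].
- by rewrite (_ : Ordinal _ = 0) //; apply: val_inj.
- by rewrite (_ : Ordinal _ = 1) //; apply: val_inj.
- by rewrite (_ : Ordinal _ = 2) //; apply: val_inj.
- by rewrite (_ : Ordinal _ = 3) //; apply: val_inj.
Qed.

(** * Scott's inequality, and Kronecker products acting on rectangular matrices *)

Section Scott.
Variable F : fieldType.

(** Factor each [T i - 1%:M] as [C i *m R i] through its rank. The left kernel of the assembled [U]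
    consists of common fixed row vectors, the cokernel of [V] of common fixed column vectors, and
    [U *m V = 0] bounds the sum of the two ranks. *)
Lemma scott n (T : 'I_4 -> 'M[F]_n) :
    T 0 *m T 1 *m T 2 *m T 3 = 1%:M ->
  exists K L : 'M[F]_n, [/\ forall i, K *m T i = K, forall i, T i *m L = L
    & (n + n <= \sum_i \rank (T i - 1%:M)%R + \rank K + \rank L)%N].
Proof.
move=> T1.
pose C i := col_base (T i - 1%:M); pose R i := row_base (T i - 1%:M).
have CR i : C i *m R i = T i - 1%:M by exact: mulmx_base.
clearbody C R.
pose U := row_mx (row_mx (C 0) (C 1)) (row_mx (C 2) (C 3)).
pose V := col_mx (col_mx (R 0 *m T 1 *m T 2 *m T 3) (R 1 *m T 2 *m T 3))
                 (col_mx (R 2 *m T 3) (R 3)).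
(* The product telescopes to [T 0 *m T 1 *m T 2 *m T 3 - 1%:M]. *)
have UV : U *m V = 0.
  rewrite /U /V !mul_row_col !mulmxA !CR !mulmxBl !mul1mx T1.
  by rewrite subrKA subrKA subrKA subrr.
have fixC m (A : 'M_(m, n)) i : A *m C i = 0 -> A *m T i = A.
  move=> AC; apply/eqP; rewrite -subr_eq0 -[X in _ - X]mulmx1 -mulmxBr -CR.
  by rewrite mulmxA AC mul0mx.
have fixR m (A : 'M_(n, m)) i : R i *m A = 0 -> T i *m A = A.
  move=> RA; apply/eqP; rewrite -subr_eq0 -[X in _ - X]mul1mx -mulmxBl -CR.
  by rewrite -mulmxA RA mulmx0.
exists (kermx U), (cokermx V); split.
- have := mulmx_ker U; rewrite {2}/U !mul_mx_row -row_mx0 => /eq_row_mx[].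
  rewrite -[X in _ = X -> _]row_mx0 => /eq_row_mx[h0 h1].
  rewrite -[X in _ = X -> _]row_mx0 => /eq_row_mx[h2 h3].
  by apply: ord4P; apply: fixC.
- have := mulmx_coker V; rewrite {1}/V !mul_col_mx -col_mx0 => /eq_col_mx[].
  rewrite -[X in _ = X -> _]col_mx0 => /eq_col_mx[h0 h1].
  rewrite -[X in _ = X -> _]col_mx0 => /eq_col_mx[h2 h3].
  (* Block [i] of [V] is [R i] times the later [T]'s, so fixedness is proved from [T 3] down to
     [T 0]. *)
  have f3 := fixR _ _ _ h3.
  have f2 : T 2 *m cokermx V = cokermx V.
    by apply: fixR; rewrite -[RHS]h2 -mulmxA f3.
  have f1 : T 1 *m cokermx V = cokermx V.
    by apply: fixR; rewrite -[RHS]h1 -!mulmxA f3 f2.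
  apply: ord4P => //; apply: fixR.
  by rewrite -[RHS]h0 -!mulmxA f3 f2 f1.
rewrite mxrank_ker mxrank_coker; pose r i := \rank (T i - 1%:M).
have UVr : (\rank U + \rank V <= r 0%R + r 1%R + (r 2%R + r 3%R))%N.
  exact: mulmx0_rank_max UV.
have -> : (\sum_i r i)%N = (r 0%R + r 1%R + r 2%R + r 3%R)%N.
  rewrite !big_ord_recl big_ord0 addn0 !addnA; congr (_ + _ + _ + _)%N;
  by congr r; apply: val_inj.
have := rank_leq_row U; have := rank_leq_col V; lia.
Qed.

(** Entries are indexed as in [*t], so that right multiplication by a Kronecker product becomes a
    two-sided multiplication ([unvec_tens]). *)
Definition unvec m n (u : 'rV[F]_(m * n)) : 'M[F]_(m, n) :=
  \matrix_(i, j) u 0 (mxtens_index (i, j)).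

Lemma unvec_is_linear m n : linear (@unvec m n).
Proof. by move=> a u v; apply/matrixP=> i j; rewrite !mxE. Qed.

HB.instance Definition _ m n :=
  GRing.isLinear.Build F 'rV[F]_(m * n) 'M[F]_(m, n) _ (@unvec m n)
    (@unvec_is_linear m n).

Lemma unvec_inj m n : injective (@unvec m n).
Proof.
move=> u v uv; apply/rowP=> k; case: (mxtens_indexP k) => i j.
by have := congr1 (fun A : 'M_(m, n) => A i j) uv; rewrite !mxE.
Qed.

Lemma unvec_tens m n p q (A : 'M[F]_(m, p)) (B : 'M[F]_(n, q)) u :
  unvec (u *m (A *t B)) = A^T *m unvec u *m B.
Proof.
apply/matrixP=> i j; rewrite !mxE.
under [RHS]eq_bigr => l _ do rewrite mxE mulr_suml.
rewrite exchange_big pair_big /=.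
rewrite (reindex (fun p : 'I_m * 'I_n => mxtens_index p)) /=; last first.
  by exists (@mxtens_unindex m n)=> k; rewrite (mxtens_indexK, mxtens_unindexK).
by apply: eq_bigr => -[k l] _; rewrite tensmxE !mxE /= mulrCA mulrA.
Qed.

Lemma tensmx11 m n : (1%:M *t 1%:M : 'M[F]_(m * n)) = 1%:M.
Proof.
apply/matrixP=> i j; case: (mxtens_indexP i) => k l.
case: (mxtens_indexP j) => k' l'; rewrite tensmxE !mxE.
by rewrite (can_eq (@mxtens_indexK m n)) xpair_eqE -mulnb natrM.
Qed.

Lemma mxrank_tens_leq m n p q (A : 'M[F]_(m, p)) (B : 'M[F]_(n, q)) :
  (\rank (A *t B) <= \rank A * \rank B)%N.
Proof.
rewrite -{1}(mulmx_base A) -{1}(mulmx_base B) -tensmx_mul.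
exact: leq_trans (mxrankM_maxl _ _) (rank_leq_col _).
Qed.

(** Up to the invertible factor [A *t 1%:M], the matrix is [1%:M *t B - A *t 1%:M]; its multiple by
    [a - b] is a difference of two Kronecker products, each of rank at most [r * s]. *)
Lemma mxrank_tens_sub1 m n r s (a b : F) (A : 'M[F]_m) (B : 'M[F]_n) :
    a != b -> A \in unitmx ->
    (\rank (A - a%:M)%R <= r)%N -> (\rank (A - b%:M)%R <= r)%N ->
    (\rank (B - a%:M)%R <= s)%N -> (\rank (B - b%:M)%R <= s)%N ->
  (\rank (invmx A *t B - 1%:M)%R <= r * s + r * s)%N.
Proof.
move=> ab Au Aa Ab Ba Bb.
have -> : invmx A *t B - 1%:M = ((a - b)^-1 *: (invmx A *t 1%:M)) *m
    ((A - b%:M) *t (B - a%:M) - (A - a%:M) *t (B - b%:M)).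
  have -> : (A - b%:M) *t (B - a%:M) - (A - a%:M) *t (B - b%:M)
            = (a - b) *: (1%:M *t B - A *t 1%:M).
    apply/matrixP=> i j; case: (mxtens_indexP i) => k l.
    case: (mxtens_indexP j) => k' l'; rewrite !(mxE, mxtens_indexK) /=.
    rewrite -!(mulr_natr a) -!(mulr_natr b).
    move: (A k k') (B l l') (k == k')%:R (l == l')%:R => x y u v; ring.
  rewrite -scalemxAl -scalemxAr scalerA mulVf ?subr_eq0 // scale1r.
  by rewrite mulmxBr !tensmx_mul !mulmx1 !mul1mx mulVmx // tensmx11.
apply: leq_trans (mxrankM_maxr _ _) _; apply: leq_trans (mxrank_add _ _) _.
rewrite mxrank_opp leq_add //; apply: leq_trans (mxrank_tens_leq _ _) _;
  exact: leq_mul.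
Qed.

End Scott.

(** * Intertwiners out of an irreducible quadruple of size 2 *)

Section Hom.
Variable F : fieldType.

Lemma rank1_factor m n (A : 'M[F]_(m, n)) : (\rank A <= 1)%N ->
  exists (c : 'cV_m) (r : 'rV_n), A = c *m r.
Proof.
move: (\rank A) (col_base A) (row_base A) (mulmx_base A) => [|[|//]] c r <- _.
  by exists 0, 0; rewrite mul0mx [c]thinmx0 mul0mx.
by exists c, r.
Qed.

(** Matrices act on row vectors from the right: [f |-> f *m X] is a map from the module of [N] to
    that of [M]. *)
Definition intertwines m n (N : 'I_4 -> 'M[F]_m) (M : 'I_4 -> 'M[F]_n)
  (X : 'M[F]_(m, n)) := forall j, X *m M j = N j *m X.

(** In size 2 this is irreducibility, since a proper nonzero invariant subspace is a line. *)
Definition no_common_eigenvector n (N : 'I_4 -> 'M[F]_n) :=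
  forall c : 'cV_n, (forall j, exists g, N j *m c = g *: c) -> c = 0.

(** A form of Schur's lemma: a nonzero kernel leaves [X] of rank at most 1, so [X = c *m r], and the
    column [c] spans an invariant line. *)
Lemma intertwines_inj n (N : 'I_4 -> 'M[F]_2) (M : 'I_4 -> 'M[F]_n) X
    (f : 'rV_2) : no_common_eigenvector N -> intertwines N M X ->
  f *m X = 0 -> f != 0 -> X = 0.
Proof.
move=> irrN NX fX f0.
have rX : (\rank X <= 1)%N.
  by have := mulmx0_rank_max fX; rewrite rank_rV f0.
have [c [r Xcr]] := rank1_factor rX.
have [r0|rn0] := eqVneq r 0; first by rewrite Xcr r0 mulmx0.
have/row_freeP[s rs] : row_free r by rewrite /row_free rank_rV rn0.
(* Cancelling [r] by its right inverse [s] exhibits the eigenvalue of [N j] on [c]. *)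
rewrite Xcr [c]irrN ?mul0mx // => j; exists ((r *m M j *m s) 0 0).
rewrite -mul_mx_scalar -mx11_scalar.
have := NX j; rewrite Xcr => /(congr1 (mulmx^~ s)).
by rewrite -!mulmxA rs mulmx1.
Qed.

(** A linear relation [u *m X + v *m Y = 0] between the rows is turned into one with scalar
    coefficients by means of the rank-one matrices [N 0 - a%:M] and [N 0 - b%:M]. *)
Lemma intertwiners_dependent (N : 'I_4 -> 'M[F]_2) (M : 'I_4 -> 'M[F]_4) a b
    (X Y : 'M[F]_(2, 4)) :
    a != b -> (\rank (N 0 - a%:M)%R <= 1)%N -> (\rank (N 0 - b%:M)%R <= 1)%N ->
    N 3 = - 1%:M -> M 3 + 1%:M != 0 ->
    no_common_eigenvector N -> intertwines N M X -> intertwines N M Y ->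
  exists s t, ~~ ((s == 0) && (t == 0)) /\ s *: X + t *: Y = 0.
Proof.
move=> ab rka rkb N3 M3 irrN NX NY.
have [w w0 wXY] : exists2 w : 'rV_(2 + 2), w != 0 & w *m col_mx X Y = 0.
  (* Since [N 3] is the scalar -1, the stacked matrix kills the nonzero [M 3 + 1%:M], hence is
     singular. *)
  have XY0 : col_mx X Y *m (M 3 + 1%:M) = 0.
    rewrite mul_col_mx !mulmxDr !mulmx1 NX NY N3 !mulNmx !mul1mx !addNr.
    by rewrite col_mx0.
  suff : kermx (col_mx X Y) != 0.
    by case/rowV0Pn=> w /sub_kermxP ? ?; exists w.
  rewrite kermx_eq0; apply: contra M3 => XYfree.
  have /row_fullP[Z ZXY] : row_full (col_mx X Y).
    by rewrite /row_full (eqP XYfree).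
  by have := congr1 (mulmx Z) XY0; rewrite mulmxA ZXY mul1mx mulmx0 => ->.
move: w0 wXY; rewrite -[w]hsubmxK; move: (lsubmx w) (rsubmx w) => u v uv0.
rewrite mul_row_col => uXvY.
(* Multiplying [u] and [v] by [N 0 - c%:M = p *m f] preserves the relation and makes both multiples
   of [f]. Then [f] is killed by the intertwiner [s *: X + t *: Y], which must vanish. *)
have key c : (\rank (N 0 - c%:M)%R <= 1)%N ->
    (u *m (N 0 - c%:M) = 0 /\ v *m (N 0 - c%:M) = 0) \/
    exists s t, ~~ ((s == 0) && (t == 0)) /\ s *: X + t *: Y = 0.
  move=> /rank1_factor[p [f Npf]].
  have NcX Z : intertwines N M Z -> (N 0 - c%:M) *m Z = Z *m (M 0 - c%:M).
    by move=> NZ; rewrite mulmxBl mulmxBr NZ scalar_mxC.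
  pose s := (u *m p) 0 0; pose t := (v *m p) 0 0.
  have us : u *m (N 0 - c%:M) = s *: f.
    by rewrite Npf mulmxA [u *m p]mx11_scalar mul_scalar_mx.
  have vt : v *m (N 0 - c%:M) = t *: f.
    by rewrite Npf mulmxA [v *m p]mx11_scalar mul_scalar_mx.
  have [f0|fn0] := eqVneq f 0; first by left; rewrite us vt f0 !scaler0.
  have [/andP[/eqP s0 /eqP t0]|st] := boolP ((s == 0) && (t == 0)).
    by left; rewrite us vt s0 t0 !scale0r.
  right; exists s, t; split => //.
  apply: (@intertwines_inj _ N M _ f irrN _ _ fn0).
    by move=> j; rewrite mulmxDl mulmxDr -!scalemxAl -!scalemxAr NX NY.
  rewrite mulmxDr -!scalemxAr !scalemxAl -us -vt -!mulmxA !NcX //.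
  by rewrite !mulmxA -mulmxDl uXvY mul0mx.
have [[ua va]|//] := key a rka; have [[ub vb]|//] := key b rkb.
(* A vector cannot be an eigenvector for both [a] and [b], so [u] and [v] would both be zero. *)
have eq0 (w' : 'rV_2) :
    w' *m (N 0 - a%:M) = 0 -> w' *m (N 0 - b%:M) = 0 -> w' = 0.
  move=> /eqP + /eqP; rewrite !mulmxBr !subr_eq0 => /eqP -> /eqP/eqP.
  rewrite -subr_eq0 -mulmxBr -raddfB /= mul_mx_scalar scaler_eq0 subr_eq0.
  by rewrite (negPf ab) => /eqP.
by move: uv0; rewrite (eq0 _ ua ub) (eq0 _ va vb) row_mx0 eqxx.
Qed.

(** Two rows of [row_base K] are independent, and remain so after the injective [unvec]. *)
Lemma intertwiners_rank_leq1 (N : 'I_4 -> 'M[F]_2) (M : 'I_4 -> 'M[F]_4) a b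
    k (K : 'M[F]_(k, 2 * 4)) :
    a != b -> (\rank (N 0 - a%:M)%R <= 1)%N -> (\rank (N 0 - b%:M)%R <= 1)%N ->
    N 3 = - 1%:M -> M 3 + 1%:M != 0 -> no_common_eigenvector N ->
    (forall u, (u <= K)%MS -> intertwines N M (unvec u)) ->
  (\rank K <= 1)%N.
Proof.
move=> ab rka rkb N3 M3 irrN NK; rewrite leqNgt; apply/negP => rK.
pose B := row_base K; pose i0 := Ordinal (ltnW rK); pose i1 := Ordinal rK.
have NB i : intertwines N M (unvec (row i B)).
  by apply: NK; rewrite (submx_trans (row_sub _ _)) // eq_row_base.
have [s [t [st0 st]]] :=
  intertwiners_dependent ab rka rkb N3 M3 irrN (NB i0) (NB i1).
pose w : 'rV[F]_(\rank K) := s *: delta_mx 0 i0 + t *: delta_mx 0 i1.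
have wB : w *m B = 0.
  rewrite mulmxDl -!scalemxAl -!rowE; apply: unvec_inj.
  by rewrite linearD !linearZ linear0.
have /eqP := wB; rewrite mulmx_free_eq0 ?row_base_free // => /eqP w0.
have s0 : s = 0.
  have := congr1 (fun v : 'rV_ _ => v 0 i0) w0.
  by rewrite !mxE /= mulr1 mulr0 addr0.
have t0 : t = 0.
  have := congr1 (fun v : 'rV_ _ => v 0 i1) w0.
  by rewrite !mxE /= mulr1 mulr0 add0r.
by rewrite s0 t0 eqxx in st0.
Qed.

End Hom.

(** * The quadruples [N]: irreducibility and existence *)

Section Quads.
Variable F : fieldType.
Implicit Types alpha beta : 'I_3 -> F.

Lemma emb3E :
  (emb3 0 = 0) * (emb3 1 = 1) * (emb3 2 = 2) * (ord_max = 3 :> 'I_4).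
Proof. by do !split; apply: val_inj. Qed.

Lemma ord3P (P : 'I_3 -> Prop) : P 0 -> P 1 -> P 2 -> forall j, P j.
Proof.
move=> P0 P1 P2 [[|[|[|//]]] lti].
- by rewrite (_ : Ordinal _ = 0) //; apply: val_inj.
- by rewrite (_ : Ordinal _ = 1) //; apply: val_inj.
- by rewrite (_ : Ordinal _ = 2) //; apply: val_inj.
Qed.

Lemma prod3 (g : 'I_3 -> F) : \prod_j g j = g 0 * g 1 * g 2.
Proof.
rewrite !big_ord_recl big_ord0 mulr1 mulrA.
by congr (_ * g _ * g _); apply: val_inj.
Qed.

Lemma generic_prod_neq alpha beta (g : 'I_3 -> F) :
    relatively_generic alpha beta ->
    (forall j, g j = alpha j \/ g j = beta j) ->
  - (g 0 * g 1 * g 2) <> 1.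
Proof.
move=> gen gab; rewrite -prod3 => g1.
(* This is the case [m = 1], with exponent [k j] equal to 1 when [alpha j] is chosen and 0
   otherwise; genericity would force [m = 2]. *)
have [] := gen 1%N (fun j => (g j == alpha j) : nat) isT.
- by move=> j; case: (g j == _).
- rewrite expr1 mulN1r -[RHS]g1; congr (- _); apply: eq_bigr => j _.
  case: eqP (gab j) => [-> _|? [//|->]]; first by rewrite expr1 expr0 mulr1.
  by rewrite expr0 expr1 mul1r.
- by [].
Qed.

Lemma diag_class1_root n (a b g : F) (A : 'M[F]_n) : diag_class 1 a b A ->
  root (char_poly A) g -> g = a \/ g = b.
Proof.
by case=> _ ->; rewrite !expr1 rootM !root_XsubC => /orP[] /eqP; [left|right].
Qed.

(** On a common eigenvector the product relation reads [- (g 0 * g 1 * g 2) = 1] with each [g j] an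
    eigenvalue, against genericity. The transposed half concerns row eigenvectors. *)
Lemma Nquad_no_common_eigenvector alpha beta (N : quad F 2) :
  relatively_generic alpha beta -> Nquad alpha beta N ->
  no_common_eigenvector N /\ no_common_eigenvector (fun j => (N j)^T).
Proof.
move=> gen [Nab N4 N1]; rewrite emb3E in N4; rewrite /prod_is_id N4 in N1.
split=> c /fin_all_exists[g Ng]; apply: contraTeq isT => c0; exfalso.
- apply: (generic_prod_neq (g := g \o emb3) gen).
    move=> j; apply: diag_class1_root (Nab j) _.
    exact: eigen_col_root (Ng _) c0.
  have /eqP : c = - (g 0 * g 1 * g 2) *: c.
    rewrite -[LHS]mul1mx -N1 -!mulmxA mulNmx mul1mx !mulmxN Ng -!scalemxAr Ng.
    by rewrite -!scalemxAr Ng !scalerA scaleNr; congr (- (_ *: _)); ring.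
  rewrite -subr_eq0 -{1}[c]scale1r -scalerBl scaler_eq0 (negPf c0) orbF.
  rewrite subr_eq0.
  by rewrite /= !emb3E => /eqP.
- have gN j : c^T *m N j = g j *: c^T.
    by rewrite -[N j]trmxK -trmx_mul Ng linearZ.
  have cT0 : c^T != 0 by rewrite trmx_eq0.
  apply: (generic_prod_neq (g := g \o emb3) gen).
    move=> j; apply: diag_class1_root (Nab j) _.
    exact: eigen_row_root (gN _) cT0.
  have /eqP : c^T = - (g 0 * g 1 * g 2) *: c^T.
    rewrite -[LHS]mulmx1 -N1 !mulmxA mulmxN mulmx1 gN -!scalemxAl gN.
    by rewrite -!scalemxAl gN !scalerA scaleNr.
  rewrite -subr_eq0 -{1}[c^T]scale1r -scalerBl scaler_eq0 (negPf cT0) orbF.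
  rewrite subr_eq0.
  by rewrite /= !emb3E => /eqP.
Qed.

Definition mx2 (a b c d : F) : 'M[F]_2 :=
  \matrix_(i, j) if i == 0 then if j == 0 then a else b
                 else if j == 0 then c else d.

Lemma mx2_tr a b c d : \tr (mx2 a b c d) = a + d.
Proof. by rewrite /mxtrace !big_ord_recl big_ord0 !mxE /= addr0. Qed.

Lemma mx2_mul a b c d a' b' c' d' :
  mx2 a b c d *m mx2 a' b' c' d' =
  mx2 (a * a' + b * c') (a * b' + b * d') (c * a' + d * c') (c * b' + d * d').
Proof.
apply/matrixP=> i j; rewrite !mxE !big_ord_recl big_ord0 !mxE /= addr0.
by do 2!case: (_ == 0).
Qed.

Lemma mx2_det a b c d : \det (mx2 a b c d) = a * d - b * c.
Proof.
rewrite (expand_det_row _ 0) !big_ord_recl big_ord0 addr0 /cofactor.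
by rewrite !det_mx11 !mxE /= expr0 expr1 mul1r mulN1r mulrN.
Qed.

Lemma mx2_scalar a : mx2 a 0 0 a = a%:M.
Proof.
apply/matrixP=> i j; rewrite !mxE -(inj_eq val_inj).
by case: i j => [[|[|//]] ?] [[|[|//]] ?].
Qed.

Lemma Nquad_exists alpha beta :
    (forall j, alpha j != beta j) -> \prod_j (alpha j * beta j) = 1 ->
  exists N, Nquad alpha beta N.
Proof.
have detC (k x w p q r : F) :
    k * (q * w) * (k * (p * x)) - k * - p * (k * - (q * (x * w - r)))
    = p * q * r * (k * k) by ring.
move=> ab; rewrite prod3; set a := alpha; set b := beta => ab1.
have [a0n0 b0n0 ab2n0] : [/\ a 0 != 0, b 0 != 0 & a 2 * b 2 != 0].
  have: a 0 * b 0 * (a 1 * b 1) * (a 2 * b 2) != 0 by rewrite ab1 oner_eq0.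
  by rewrite !mulf_eq0 !negb_or => /andP[/andP[/andP[-> ->] _] ->].
(* [x] and [w] solve [x + w = a 1 + b 1] and
   [a 0 * x + b 0 * w = - (a 2 + b 2) / (a 2 * b 2)]. *)
have [x [w [xw axbw]]] : exists x w, x + w = a 1 + b 1 /\
    - (a 2 * b 2) * (a 0 * x + b 0 * w) = a 2 + b 2.
  pose t := - (a 2 + b 2) / (a 2 * b 2).
  pose x := (t - b 0 * (a 1 + b 1)) / (a 0 - b 0).
  exists x, (a 1 + b 1 - x); split; first by rewrite addrC subrK.
  have -> : a 0 * x + b 0 * (a 1 + b 1 - x) = t.
    have -> : a 0 * x + b 0 * (a 1 + b 1 - x)
              = (a 0 - b 0) * x + b 0 * (a 1 + b 1) by ring.
    by rewrite /x mulrC divfK ?subr_eq0 ?ab // subrK.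
  by rewrite /t mulNr mulrC mulNr mulNr opprK divfK.
(* [z] gives [B] the determinant [a 1 * b 1]. [C] is [k] times the adjugate of [A *m B], whose
   determinant is the inverse of [a 2 * b 2]; thus [C] is minus the inverse of [A *m B]. *)
pose z := x * w - a 1 * b 1.
pose k := - (a 2 * b 2).
pose A := mx2 (a 0) 0 0 (b 0); pose B := mx2 x 1 z w.
pose C := mx2 (k * (b 0 * w)) (k * - a 0) (k * - (b 0 * z)) (k * (a 0 * x)).
exists (fun j => nth 0 [:: A; B; C; - 1%:M] j).
have cp j (M : 'M[F]_2) : \tr M = a j + b j -> \det M = a j * b j ->
    diag_class 1 (a j) (b j) M.
  by move=> *; apply: diag_class1; rewrite ?ab //; apply: char_poly2.
split=> //.
  apply: ord3P.
  - by apply: (cp 0 A); rewrite /A ?mx2_tr ?mx2_det // mulr0 subr0.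
  - by apply: (cp 1 B); rewrite /B ?mx2_tr ?mx2_det // /z; ring.
  - apply: (cp 2 C); rewrite /C ?mx2_tr ?mx2_det.
      by rewrite -axbw /k; ring.
    by rewrite /z detC /k mulrNN [LHS]mulrA ab1 mul1r.
rewrite /prod_is_id /= mulmxN mulmx1 /A /B /C !mx2_mul.
rewrite -mx2_scalar; apply/matrixP=> i j; rewrite !mxE.
have e : - (k * (a 0 * b 0 * (a 1 * b 1))) = 1 by rewrite -[RHS]ab1 /k; ring.
case: (i == 0); case: (j == 0); try by ring.
  by rewrite -[RHS]e /z; ring.
by rewrite -[RHS]e /z; ring.
Qed.

End Quads.

(** * Nonzero intertwiners in both directions, by dimension count *)

Section Intertwiners.
Variable F : fieldType.
Variables alpha beta : 'I_3 -> F.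
Hypothesis alpha_neq_beta : forall j, alpha j != beta j.
Hypothesis generic : relatively_generic alpha beta.

(** The nilpotent part is conjugate to the single matrix unit [delta_mx 0 1]. *)
Lemma jordan_211_sub (M : 'M[F]_4) (c : F) : conj_class (jordan_211 c) M ->
  [/\ \rank (M - c%:M) = 1%N, (M - c%:M) *m (M - c%:M) = 0 & M - c%:M != 0].
Proof.
case=> Q Qu /(simmxP Qu); rewrite jordan_211E => QM.
have ME : M - c%:M = invmx Q *m delta_mx 0 1 *m Q.
  rewrite -mulmxA; apply: (canRL (mulKmx Qu)).
  by rewrite mulmxBr QM mulmxDl scalar_mxC addrAC subrr add0r.
have rk1 : \rank (M - c%:M) = 1%N.
  rewrite ME mxrankMfree ?row_free_unit //.
  by rewrite eqmxMfull ?row_full_unit ?unitmx_inv ?mxrank_delta.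
split=> //; last by rewrite -mxrank_eq0 rk1.
rewrite ME -!mulmxA (mulKVmx Qu) (mulmxA (delta_mx 0 1)).
by rewrite mul_delta_mx_0 // mul0mx mulmx0.
Qed.

Lemma prod_is_id_unit n (N : quad F n) j : prod_is_id N -> N j \in unitmx.
Proof.
move=> /(congr1 determinant); rewrite !det_mulmx det1 => N1.
have : \det (N 0) * \det (N 1) * \det (N 2) * \det (N 3) != 0.
  by rewrite N1 oner_eq0.
rewrite !mulf_eq0 !negb_or -!andbA => /and4P[]; rewrite -!unitfE -!unitmxE.
by move=> *; move: j; apply: ord4P.
Qed.

Lemma intertwiners_exist (N : quad F 2) (M : quad F 4) :
    Nquad alpha beta N -> calV alpha beta M ->
  (exists2 X, intertwines N M X & X != 0) /\
  (exists2 Y, (forall j, M j *m Y = Y *m N j) & Y != 0).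
Proof.
move=> NN [Mab M4 M1].
have [irrN irrNT] := Nquad_no_common_eigenvector generic NN.
have [Nab N3 N1] := NN; rewrite emb3E in N3 M4.
have [rkM3 _ M3n0] := jordan_211_sub M4.
rewrite raddfN /= opprK in rkM3 M3n0.
have Nu j := prod_is_id_unit j N1.
have NTu j : (N j)^T \in unitmx by rewrite unitmx_tr.
(* Through [unvec], this is the action sending [X] to [invmx (N j) *m X *m M j]; its fixed vectors
   are the intertwiners. *)
pose T j := invmx (N j)^T *t M j.
have T1 : T 0 *m T 1 *m T 2 *m T 3 = 1%:M.
  rewrite !tensmx_mul M1 -[RHS]tensmx11; congr (_ *t _).
  have NT1 : (N 3)^T *m (N 2)^T *m (N 1)^T *m (N 0)^T = 1%:M.
    by rewrite -!trmx_mul !mulmxA N1 trmx1.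
  by rewrite -[LHS]mulmx1 -NT1 !mulmxA !mulmxKV // mulVmx.
have [K [L [KT TL rkKL]]] := scott T1.
have ab0 := alpha_neq_beta 0.
have [Na Nb] := diag_class_rank ab0 (Nab 0); rewrite emb3E in Na Nb.
have rkT (A : 'M_2) c : (\rank (A^T - c%:M)%R = \rank (A - c%:M)%R)%N.
  by rewrite -[in RHS]mxrank_tr linearB /= tr_scalar_mx.
have KX u : (u <= K)%MS -> intertwines N M (unvec u).
  case/submxP=> D -> j; rewrite -{2}(KT j) mulmxA unvec_tens trmx_inv trmxK.
  by rewrite -[in RHS]mulmxA mulKVmx // mulmxA.
(* Fixed columns of [T], transposed, are intertwiners of the transposed quadruples, that is,
   transposes of maps from [M] to [N]. *)
have LX u : (u <= L^T)%MS ->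
    intertwines (fun j => (N j)^T) (fun j => (M j)^T) (unvec u).
  case/submxP=> D -> j; rewrite -{2}(TL j) trmx_mul mulmxA trmx_tens unvec_tens.
  by rewrite trmxK -mulmxA mulKVmx // mulmxA.
have rkK : (\rank K <= 1)%N.
  by apply: (intertwiners_rank_leq1 ab0 Na Nb N3 M3n0 irrN KX).
have rkL : (\rank L <= 1)%N.
  rewrite -mxrank_tr; apply: (intertwiners_rank_leq1 ab0 _ _ _ _ irrNT LX).
  - by rewrite rkT.
  - by rewrite rkT.
  - by rewrite N3 raddfN /= trmx1.
  - by rewrite -trmx1 -raddfD /= trmx_eq0.
have rkTj (j : 'I_3) : (\rank (T (emb3 j) - 1%:M)%R <= 4)%N.
  have abj := alpha_neq_beta j.
  have [Nja Njb] := diag_class_rank abj (Nab j).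
  have [Mja Mjb] := diag_class_rank abj (Mab j).
  by apply: (mxrank_tens_sub1 (r := 1) (s := 2) abj); rewrite ?rkT.
have rkT3 : (\rank (T 3 - 1%:M)%R <= 2)%N.
  have -> : T 3 - 1%:M = - (1%:M *t (M 3 + 1%:M)).
    have -> : T 3 = - (1%:M *t M 3).
      have i1 : invmx (- 1%:M)^T = - 1%:M :> 'M[F]_2.
        by rewrite raddfN /= trmx1 -raddfN /= invmx_scalar invrN1.
      by rewrite /T N3 i1; apply/matrixP=> i j; rewrite !mxE mulNr.
    rewrite -tensmx11 -opprD; congr (- _).
    by apply/matrixP=> i j; rewrite !mxE mulrDr.
  rewrite mxrank_opp; apply: leq_trans (mxrank_tens_leq _ _) _.
  by rewrite rkM3 muln1 mxrank1.
have rkSum : (\sum_j \rank (T j - 1%:M)%R <= 4 + 4 + 4 + 2)%N.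
  rewrite big_ord_recr /=; apply: leq_add.
    rewrite !big_ord_recl big_ord0 addn0 addnA.
    apply: leq_add; [apply: leq_add|];
    [have := rkTj 0|have := rkTj 1|have := rkTj 2]; apply: leq_trans;
    by rewrite eq_leq //; congr (\rank (T _ - _)); apply: val_inj.
  by rewrite [ord_max]emb3E.
have nz k l (U : 'M[F]_(k, l * 4)) : (0 < \rank U)%N ->
    exists2 u : 'rV_(l * 4), (u <= U)%MS & unvec u != 0.
  rewrite lt0n mxrank_eq0 => /rowV0Pn[u uU u0]; exists u => //.
  by apply: contraNneq u0 => u0; apply/eqP/unvec_inj; rewrite u0 raddf0.
(* The two ranks add up to at least 2 and neither exceeds 1, so both are positive. *)
have rk2 : (8 + 8 <= 14 + \rank K + \rank L)%N.
  by apply: leq_trans rkKL _; rewrite !leq_add2r.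
have K0 : (0 < \rank K)%N.
  by move: rk2 rkL; case: (\rank K) => // ; case: (\rank L) => [|[|]].
have L0 : (0 < \rank L)%N.
  by move: rk2 rkK; case: (\rank L) => // ; case: (\rank K) => [|[|]].
split.
  have [u uK u0] := nz _ 2 K K0.
  by exists (unvec u) => //; apply: KX.
have [|u uL u0] := nz _ 2 L^T; first by rewrite mxrank_tr.
exists (unvec u)^T; last by rewrite trmx_eq0.
by move=> j; apply: trmx_inj; rewrite !trmx_mul trmxK LX.
Qed.

End Intertwiners.

(** * Block forms of [M] obtained from the two intertwiners *)

Section Assembly.
Variable F : fieldType.

Lemma intertwines_free n (N : 'I_4 -> 'M[F]_2) (M : 'I_4 -> 'M[F]_n) X :
    no_common_eigenvector N -> intertwines N M X -> X != 0 -> row_free X.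
Proof.
move=> irrN NX X0; apply: inj_row_free => f fX; apply/eqP.
by apply: contraNT X0 => f0; apply/eqP; apply: intertwines_inj NX fX f0.
Qed.

(** Applying [Z] to a relation between the rows removes [Y] and forces the coefficients of [X] to
    vanish; freeness of [Y] handles the others. *)
Lemma col_mx_unit (X Y : 'M[F]_(2, 4)) (Z : 'M[F]_(4, 2)) :
    row_free Y -> Y *m Z = 0 -> X *m Z \in unitmx ->
  (col_mx X Y : 'M_(2 + 2)) \in unitmx.
Proof.
move=> Yfree YZ XZ; rewrite -row_free_unit; apply: inj_row_free => v.
rewrite -[v]hsubmxK mul_row_col => vXY.
have v0 : lsubmx v = 0.
  apply: (can_inj (mulmxK XZ)); rewrite mul0mx mulmxA.
  have := congr1 (mulmx^~ Z) vXY.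
  by rewrite mulmxDl mul0mx -(mulmxA _ Y) YZ mulmx0 addr0.
move: vXY; rewrite v0 mul0mx add0r => /eqP.
by rewrite mulmx_free_eq0 // => /eqP ->; rewrite row_mx0.
Qed.

(** Gives the kernel a basis whose type has literally 2 rows, as needed for [block_mx] with blocks
    of size 2. *)
Lemma kermx_basis (Y : 'M[F]_(4, 2)) : \rank Y = 2 ->
  exists K : 'M[F]_(2, 4), [/\ row_free K, K *m Y = 0
    & forall Z : 'M[F]_(2, 4), Z *m Y = 0 -> (Z <= K)%MS].
Proof.
move=> rkY; have rkK : \rank (kermx Y) = 2 by rewrite mxrank_ker rkY.
have : [/\ row_free (row_base (kermx Y)), (row_base (kermx Y)) *m Y = 0
    & forall Z : 'M[F]_(2, 4), Z *m Y = 0 -> (Z <= row_base (kermx Y))%MS].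
  split; first exact: row_base_free.
    by apply/sub_kermxP; rewrite eq_row_base.
  by move=> Z /sub_kermxP; rewrite eq_row_base.
by move: (row_base _); rewrite rkK => K; exists K.
Qed.

Section Splitting.
Variables alpha beta : 'I_3 -> F.
Hypothesis alpha_neq_beta : forall j, alpha j != beta j.
Variables (N : quad F 2) (M : quad F 4).
Hypothesis NN : Nquad alpha beta N.
Hypothesis VM : calV alpha beta M.

(** By dimension the row space of [X] is the kernel of [Y]. Completing [X] by a section [Z] of [Y]
    gives the triangular form, [R j] measuring how far [Z] is from intertwining. *)
Lemma calW_intro X Y :
    intertwines N M X -> row_free X ->
    (forall j, M j *m Y = Y *m N j) -> \rank Y = 2 -> X *m Y = 0 ->
  calW alpha beta M.
Proof.
move=> NX Xfree MY rkY XY; split=> //.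
have [K [Kfree KY Kmax]] := kermx_basis rkY.
have KX : (K <= X)%MS.
  rewrite -(geq_leqif (mxrank_leqif_sup (Kmax X XY))).
  by rewrite (eqP Kfree) (eqP Xfree).
have /row_fullP[Z ZY] : row_full Y by rewrite /row_full rkY.
pose R j := (Z *m M j - N j *m Z) *m pinvmx X.
have RX j : R j *m X = Z *m M j - N j *m Z.
  apply: mulmxKpV; apply: submx_trans (Kmax _ _) KX.
  by rewrite mulmxBl -!mulmxA MY (mulmxA Z) ZY mul1mx mulmx1 subrr.
pose Q : 'M_(2 + 2) := col_mx Z X.
have Qu : Q \in unitmx by apply: (col_mx_unit Xfree XY); rewrite ZY unitmx1.
have QM j : Q *m M j = block_mx (N j) (R j) 0 (N j) *m Q.
  by rewrite mul_block_col mul_col_mx RX mul0mx add0r NX addrC subrK.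
by exists N, R; split=> //; exists Q => // j; apply/simmxP.
Qed.

(** The kernel of [Y] is invariant under [M] and complementary to the row space of [X]; [P j] is the
    matrix of [M j] on it. *)
Lemma calU_intro X Y :
    intertwines N M X -> (forall j, M j *m Y = Y *m N j) -> \rank Y = 2 ->
    X *m Y \in unitmx ->
  calU alpha beta M.
Proof.
move=> NX MY rkY XY; split=> //.
have [K [Kfree KY Kmax]] := kermx_basis rkY.
pose P j := K *m M j *m pinvmx K.
have PK j : P j *m K = K *m M j.
  by apply/mulmxKpV/Kmax; rewrite -mulmxA MY mulmxA KY mul0mx.
pose Q : 'M_(2 + 2) := col_mx X K.
have Qu : Q \in unitmx by apply: col_mx_unit Kfree KY XY.
have QM j : Q *m M j = block_mx (N j) 0 0 (P j) *m Q.
  by rewrite mul_block_col mul_col_mx !mul0mx add0r addr0 NX PK.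
exists N, P; split=> //; last by exists Q => // j; apply/simmxP.
have [Mab M4 M1] := VM; have [Nab N4 N1] := NN.
split.
(* Cancelling the factor of [N] from the characteristic polynomial of [M] leaves that of [P]. *)
- move=> j; apply: diag_class1 (alpha_neq_beta j) _.
  have [_ chN] := Nab j; have [_ chM] := Mab j.
  have := char_poly_simmx Qu (QM (emb3 j)).
  rewrite char_poly_block_diag chN chM !expr1 -exprMn expr2.
  move=> /esym/mulfI -> //.
  by rewrite mulf_neq0 ?polyXsubC_eq0.
- have [_ EE E0] := jordan_211_sub M4.
  have PE : (P ord_max - (-1)%:M) *m K = K *m (M ord_max - (-1)%:M).
    by rewrite mulmxBl mulmxBr PK scalar_mxC.
  (* If [P ord_max] were the scalar -1, so would be [M ord_max], as [N ord_max] is. The square-zero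
     relation is inherited from [M]. *)
  apply: nilpotent2_jordan.
    apply: contraNneq E0 => P0; have : Q *m (M ord_max - (-1)%:M) = 0.
      rewrite mul_col_mx -PE P0 mul0mx mulmxBr NX N4.
      by rewrite mul_mx_scalar mulNmx mul1mx scaleN1r subrr col_mx0.
    by move/(canRL (mulKmx Qu)); rewrite mulmx0 => ->.
  apply: (row_free_inj Kfree); rewrite -mulmxA PE mulmxA PE -mulmxA EE.
  by rewrite mulmx0 mul0mx.
have PKM (A B : 'M_2) (A' B' : 'M_4) :
    A *m K = K *m A' -> B *m K = K *m B' -> A *m B *m K = K *m (A' *m B').
  by move=> AK BK; rewrite -mulmxA BK mulmxA AK mulmxA.
apply: (row_free_inj Kfree); rewrite mul1mx.
have PK012 := PKM _ _ _ _ (PKM _ _ _ _ (PK 0) (PK 1)) (PK 2).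
by rewrite (PKM _ _ _ _ PK012 (PK 3)) M1 mulmx1.
Qed.

End Splitting.
End Assembly.

(** * The decomposition of [calV] *)

Local Open Scope classical_set_scope.

Theorem proposition19 (R : realType) (alpha beta : 'I_3 -> R[i])
  (alpha_neq0 : forall j, alpha j != 0)
  (beta_neq0 : forall j, beta j != 0)
  (alpha_neq_beta : forall j, alpha j != beta j)
  (prod_eq1 : \prod_(j < 3) (alpha j * beta j) = 1)
  (generic : relatively_generic alpha beta) :
  calV alpha beta = calU alpha beta `|` calW alpha beta.
Proof.
apply/seteqP; split=> M; last by case=> -[].
move=> VM; have [N NN] := Nquad_exists alpha_neq_beta prod_eq1.
have [irrN irrNT] := Nquad_no_common_eigenvector generic NN.
have [[X NX X0] [Y MY Y0]] := intertwiners_exist alpha_neq_beta generic NN VM.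
(* Surjectivity of [Y] is injectivity of its transpose, an intertwiner from the transposes of
   [N]. *)
have rkY : \rank Y = 2.
  rewrite -mxrank_tr; apply/eqP.
  apply: (intertwines_free (M := fun j => (M j)^T) irrNT).
    by move=> j; rewrite -!trmx_mul MY.
  by rewrite trmx_eq0.
(* [X *m Y] is an endomorphism of the irreducible [N], hence zero or invertible. *)
have [XY0|XYn0] := eqVneq (X *m Y) 0.
  right; apply: (calW_intro NN VM NX _ MY rkY XY0).
  exact: intertwines_free NX X0.
left; apply: (calU_intro alpha_neq_beta NN VM NX MY rkY).
rewrite -row_free_unit; apply: (@intertwines_free _ _ N N _ irrN _ XYn0).
by move=> j; rewrite -mulmxA -MY !mulmxA NX.
Qed.
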